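(* Let $R$ be a finite commutative ring with identity $1\ne 0$ which is of odd type. Then $G_R$ and $G_R^+$ are integral equienergetic non-isospectral connected non-bipartite graphs. Moreover, $G_R^+$ is simple (has no loops) if $|R|$ is even, while $G_R^+$ is strongly almost symmetric with loops if $|R|$ is odd.
   Context: Every finite commutative ring $R$ with identity $1\neq0$ decomposes as $R=R_1\times\cdots\times R_s$ with each $R_i$ a local ring with maximal ideal $\mathfrak m_i$; put $r_i=|R_i|$, $m_i=|\mathfrak m_i|$. $R$ is of odd type if $m_i<\frac{r_i}{2}$ for all $i$ with $|R_i|$ even, and at least one $|R_i|$ is odd. $G_R$ is the graph with vertex set $R$ in which $v,w$ are adjacent iff $w-v\in R^*$ (the group of units); $G_R^+$ is the graph with vertex set $R$ in which $v,w$ are adjacent iff $v+w\in R^*$ (with a loop at $x$ when $x+x\in R^*$). Both are undirected and $|R^*|$-regular (a loop contributes $1$ to the degree); a graph with a loop is not bipartite. Eigenvalues are those of the adjacency matrix (a loop gives a diagonal entry $1$). A graph is integral if all its eigenvalues are integers. The energy is the sum of the absolute values of the eigenvalues with multiplicity; two graphs with equally many vertices are equienergetic if their energies agree, and isospectral if their spectra (with multiplicities) agree. A regular graph with principal eigenvalue $\lambda_0$ (its degree) is strongly almost symmetric if $m(\lambda)=m(-\lambda)$ for all $\lambda\neq\pm\lambda_0$ and $|m(\lambda_0)-m(-\lambda_0)|=1$, where $m(\lambda)$ is the multiplicity of $\lambda$ ($0$ if $\lambda$ is not an eigenvalue). *)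

(* Defs.v *)
From HB Require Import structures.
From mathcomp Require Import all_boot all_order all_algebra all_field.

Set Implicit Arguments.
Unset Strict Implicit.
Unset Printing Implicit Defensive.

Import GRing.Theory Num.Theory.
Local Open Scope ring_scope.

(* MathComp's [idealr_closed] only accepts proper ideals: it requires
   [1 \notin M]. *)
Definition maximal_ideal (R : finComNzRingType) (M : {set R}) : Prop :=
  idealr_closed M /\
  forall I : {set R}, idealr_closed I -> M \subset I -> I = M.

Definition local_with (R : finComNzRingType) (M : {set R}) : Prop :=
  maximal_ideal M /\ forall I : {set R}, maximal_ideal I -> I = M.

(* An isomorphism of R with a product of local rings is given by its
   components, ring morphisms onto the factors that are jointly bijective. *)
Record local_decomposition (R : finComNzRingType) := LocalDecomposition {
  nb_factors : nat;
  factor : 'I_nb_factors -> finComNzRingType;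
  factor_max : forall i, {set factor i};
  factor_local : forall i, local_with (factor_max i);
  component : forall i, {rmorphism R -> factor i};
  component_bij :
    bijective (fun x : R =>
      [ffun i => component i x] : {dffun forall i, factor i})
}.
Arguments factor {R} l i.
Arguments factor_max {R} l i.

(* The decomposition is unique up to isomorphism and reordering of the factors,
   so the choice of D is immaterial; [./2] is exact as it is applied to even
   numbers only. *)
Definition odd_type (R : finComNzRingType) : Prop :=
  exists D : local_decomposition R,
    (forall i, ~~ odd #|factor D i| ->
       (#|factor_max D i| < #|factor D i|./2)%N) /\
    (exists i, odd #|factor D i|).

(* An undirected graph, possibly with loops, on a finite type T is given by its
   adjacency relation, a symmetric [rel T]. *)
Definition unitary_cayley (R : finComUnitRingType) : rel R :=
  fun v w => w - v \is a GRing.unit.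

Definition unitary_cayley_sum (R : finComUnitRingType) : rel R :=
  fun v w => v + w \is a GRing.unit.

Lemma unitary_cayley_sym (R : finComUnitRingType) :
  symmetric (@unitary_cayley R).
Proof. by move=> v w; rewrite /unitary_cayley -opprB unitrN. Qed.

Lemma unitary_cayley_sum_sym (R : finComUnitRingType) :
  symmetric (@unitary_cayley_sum R).
Proof. by move=> v w; rewrite /unitary_cayley_sum addrC. Qed.

Section Graphs.

Variables (T : finType) (e : rel T).

Definition connected_graph : Prop := forall x y, connect e x y.

Definition bipartite : Prop :=
  exists c : T -> bool, forall x y, e x y -> c x != c y.

Definition loopless : Prop := forall x, ~~ e x x.

Definition has_loop : Prop := exists x, e x x.

Definition regular (k : nat) : Prop := forall x, #|[pred y | e x y]| = k.

Definition adjacency_matrix : 'M[algC]_#|T| :=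
  \matrix_(i, j) (e (enum_val i) (enum_val j))%:R.

(* The roots of the characteristic polynomial, with multiplicity. *)
Definition spectrum : seq algC :=
  sval (closed_field_poly_normal (char_poly adjacency_matrix)).

Definition eig_mult (a : algC) : nat := count_mem a spectrum.

Definition integral_graph : Prop :=
  forall a, a \in spectrum -> a \is a Num.int.

Definition energy : algC := \sum_(a <- spectrum) `|a|.

Definition strongly_almost_symmetric : Prop :=
  exists2 k : nat, regular k &
    (forall a : algC, a != k%:R -> a != - k%:R -> eig_mult a = eig_mult (- a))
    /\ `|(eig_mult k%:R)%:Z - (eig_mult (- k%:R))%:Z| = 1.

End Graphs.

Definition equienergetic (T1 T2 : finType) (e1 : rel T1) (e2 : rel T2) : Prop :=
  #|T1| = #|T2| /\ energy e1 = energy e2.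

Definition isospectral (T1 T2 : finType) (e1 : rel T1) (e2 : rel T2) : Prop :=
  perm_eq (spectrum e1) (spectrum e2).

(* Main.v *)
Require Import Defs.
From mathcomp Require Import all_boot all_order all_algebra all_field.
From mathcomp Require Import all_fingroup cyclic pgroup spectral.

Set Implicit Arguments.
Unset Strict Implicit.
Unset Printing Implicit Defensive.

Import GRing.Theory Num.Theory.
Local Open Scope ring_scope.

(** Write [A] and [A'] for the adjacency matrices of the graphs G_R and G_R^+,
    and [d] for the number of units of [R].  No eigenvalue is ever computed:
    the spectra are compared through their power sums, i.e., through the traces
    of the powers of [A] and [A'], because a finite multiset of numbers is
    determined by its power sums ([perm_eq_power_sums]).

    Energy and integrality.  Since the set of units is stable under negation,
    [A' ^+ 2 = A ^+ 2] (substitute [- y] for the middle vertex of a walk of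
    length two), so the squares of the eigenvalues form the same multiset for
    both graphs ([spectrum_cayley_sqr]).  The energies agree, and the
    eigenvalues of [A'] are integers as soon as those of [A] are.  For [A],
    inclusion-exclusion over the maximal ideals writes the indicator of the
    units as a signed sum of indicators of ideals [I].  The translation
    invariant matrices [N] of these indicators commute and satisfy
    [N ^+ 2 = #|I| *: N]; triangularizing all of them at once shows that the
    eigenvalues of [A] are sums of terms [0] and [#|I|] up to sign
    ([int_spectrum], [integral_cayley]).

    Connectedness, triangles, non-isospectrality.  All three come from the
    number [codegree t] of units [z] such that [z + t] is a unit.  It is the
    product over the local factors of the numbers of elements that avoid two
    cosets of the maximal ideal [M], which is [#|F| - 2 * #|M|] if [t] is
    outside [M] and the larger number [#|F| - #|M|] if [t] is in [M].  Odd type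
    makes the former positive: if [#|F|] is odd, because [2 * #|M| <= #|F|]
    and the parities differ.  Hence any two vertices have a common neighbour,
    which gives connectedness and triangles in both graphs.  The trace of
    [A ^+ 3] is the sum of [codegree (y - x)] over the edges of G_R, where the
    codegree takes its minimal value [codegree 1], and that of [A' ^+ 3] is the
    sum of [codegree (x - y)] over the equally many edges of G_R^+.  A factor
    of odd cardinality provides an edge of G_R^+ whose endpoints agree modulo
    its maximal ideal, so that the second trace is strictly larger
    ([not_isospectral_cayley]).

    Odd cardinality.  Then [2] is invertible, so [(x + y, x - y)] runs over all
    of [R * R] when [(x, y)] does, and for odd [k] the trace of [A' ^+ k]
    factors as [d ^+ k] ([mxtrace_cayley_sum_odd]).  So the odd power sums of
    the spectrum of [A'] with [- d] added vanish, this multiset is symmetric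
    about [0], and G_R^+ is strongly almost symmetric.  If [#|R|] is even,
    some nonzero [t] has [t + t = 0], hence no [x + x] is a unit. *)

(** * Traces and spectra *)

(** Equal power sums give equal sums of the values of any polynomial [p], and a
    [p] that vanishes on all entries of [s] and [t] but [v] isolates the
    multiplicity of [v]. *)
Lemma perm_eq_power_sums (F : numFieldType) (s t : seq F) :
  (forall k, \sum_(a <- s) a ^+ k = \sum_(a <- t) a ^+ k) -> perm_eq s t.
Proof.
move=> eq_st.
have eq_poly (p : {poly F}) : \sum_(a <- s) p.[a] = \sum_(a <- t) p.[a].
  under eq_bigr do rewrite horner_coef.
  under [RHS]eq_bigr do rewrite horner_coef.
  rewrite exchange_big [RHS]exchange_big; apply: eq_bigr => k _.
  by rewrite -!mulr_sumr eq_st.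
apply/allP => v _ /=.
pose p := \prod_(w <- undup (s ++ t) | w != v) ('X - w%:P).
have pv0 : p.[v] != 0.
  rewrite horner_prod prodf_seq_neq0; apply/allP => w _.
  by apply/implyP => wv; rewrite hornerXsubC subr_eq0 eq_sym.
have p_sum r : {subset r <= s ++ t} ->
    \sum_(a <- r) p.[a] = p.[v] *+ count_mem v r.
  move=> sub_r; rewrite -sum1_count -sumrMnr [RHS]big_mkcond.
  apply: eq_big_seq => a ar /=.
  case: eqVneq => [-> // | nav]; apply/eqP.
  rewrite -[_ == _]/(root p a) /p -big_filter root_prod_XsubC mem_filter nav.
  by rewrite mem_undup sub_r.
have := eq_poly p; rewrite !p_sum => [|a at_|a as_].
- rewrite -[LHS]mulr_natr -[RHS]mulr_natr => /(mulfI pv0)/eqP.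
  by rewrite eqr_nat.
- by rewrite mem_cat at_ orbT.
- by rewrite mem_cat as_.
Qed.

Section Triangular.

Variables (R : pzSemiRingType) (n : nat).
Implicit Types A B : 'M[R]_n.

Lemma trigmx_mul A B : is_trig_mx A -> is_trig_mx B -> is_trig_mx (A *m B).
Proof.
move=> /is_trig_mxP At /is_trig_mxP Bt; apply/is_trig_mxP => i j ltij.
rewrite mxE big1 // => k _; case: (ltnP i k) => [ltik | leki].
  by rewrite At // mul0r.
by rewrite Bt ?mulr0 // (leq_ltn_trans leki).
Qed.

Lemma trigmx_mul_diag A B i :
  is_trig_mx A -> is_trig_mx B -> (A *m B) i i = A i i * B i i.
Proof.
move=> /is_trig_mxP At /is_trig_mxP Bt.
rewrite mxE (bigD1 i) //= big1 ?addr0 //.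
move=> k nki; case: (ltngtP i k) => [ltik | ltki | eqik].
- by rewrite At // mul0r.
- by rewrite Bt // mulr0.
- by rewrite (val_inj eqik) eqxx in nki.
Qed.

Lemma trigmx_exp A k : is_trig_mx A ->
  is_trig_mx (A ^+ k) /\ forall i, (A ^+ k) i i = A i i ^+ k.
Proof.
move=> At; elim: k => [|k [IHt IHd]].
  by split=> [|i]; [exact: scalar_mx_is_trig | rewrite !expr0 mxE eqxx].
rewrite exprS; split=> [|i]; first exact: trigmx_mul.
by rewrite trigmx_mul_diag // IHd exprS.
Qed.

End Triangular.

Section Similarity.

Variables (n : nat) (P : 'M[algC]_n).
Hypothesis Pu : P \in unitmx.

Lemma conjumxM A B : conjmx P (A *m B) = conjmx P A *m conjmx P B.
Proof. by rewrite !conjumx // !mulmxA mulmxKV. Qed.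

Lemma conjumxX A k : conjmx P (A ^+ k) = conjmx P A ^+ k.
Proof.
elim: k => [|k IH]; last by rewrite !exprS conjumxM IH.
by rewrite !expr0 conjumx // mulmx1 mulmxV.
Qed.

Lemma mxtrace_conjumx A : \tr (conjmx P A) = \tr A.
Proof. by rewrite conjumx // -mulmxA mxtrace_mulC -mulmxA mulVmx ?mulmx1. Qed.

Lemma char_poly_conjumx A : char_poly (conjmx P A) = char_poly A.
Proof.
rewrite conjumx // /char_poly /char_poly_mx.
have -> : 'X%:M - map_mx polyC (P *m A *m invmx P)
  = map_mx polyC P *m ('X%:M - map_mx polyC A) *m map_mx polyC (invmx P).
  rewrite mulmxBr mulmxBl !map_mxM; congr (_ - _).
  by rewrite scalar_mxC -mulmxA -map_mxM mulmxV // map_mx1 mulmx1.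
rewrite !det_mulmx mulrAC -det_mulmx -map_mxM mulmxV // map_mx1 det1.
by rewrite mul1r.
Qed.

End Similarity.

Section Spectrum.

Variables (T : finType) (e : rel T).

Lemma char_poly_spectrum :
  char_poly (adjacency_matrix e) = \prod_(a <- spectrum e) ('X - a%:P).
Proof.
rewrite /spectrum; case: closed_field_poly_normal => s /= ->.
by rewrite (monicP (char_poly_monic _)) scale1r.
Qed.

(** Any triangular form may be used, so that several commuting matrices can be
    brought to triangular form together. *)
Lemma spectrum_trig (P : 'M[algC]_#|T|) :
    P \in unitmx -> is_trig_mx (conjmx P (adjacency_matrix e)) ->
  perm_eq (spectrum e)
    [seq conjmx P (adjacency_matrix e) i i | i <- index_enum 'I_#|T|].
Proof.
move=> Pu trigA; apply: prod_XsubC_eq.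
rewrite -char_poly_spectrum -(char_poly_conjumx Pu).
by rewrite char_poly_trig // big_map.
Qed.

Lemma sum_spectrum_exp k :
  \sum_(a <- spectrum e) a ^+ k = \tr (adjacency_matrix e ^+ k).
Proof.
have [|P /unitarymx_unit Pu] :=
    @cotrigonalization algC _ [:: adjacency_matrix e].
  by move=> A B; rewrite !inE => /eqP-> /eqP->.
rewrite /= andbT => trigA; rewrite -(mxtrace_conjumx Pu) (conjumxX Pu).
rewrite (perm_big _ (spectrum_trig Pu _)) //= big_map.
by apply: eq_bigr => i _; have [_ ->] := trigmx_exp k trigA.
Qed.

Lemma mxtrace_adjacency_cube :
  \tr (adjacency_matrix e ^+ 3) =
  (\sum_x \sum_(y | e x y) #|[pred z | e y z & e z x]|)%:R.
Proof.
rewrite natr_sum /mxtrace [RHS]big_enum_val; apply: eq_bigr => i _.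
rewrite exprS expr2 mxE natr_sum [RHS]big_mkcond [RHS]big_enum_val.
apply: eq_bigr => j _; rewrite !mxE; case: ifP => _; last by rewrite mul0r.
rewrite mul1r -[in RHS]sum1_card natr_sum [RHS]big_mkcond [RHS]big_enum_val.
apply: eq_bigr => k _; rewrite !mxE !inE.
by do 2!case: (e _ _); rewrite ?mulr0 ?mul0r ?mulr1.
Qed.

(** In a common triangular form, a diagonal entry [x] of [N i] satisfies
    [x ^+ 2 = (k i)%:~R * x], so it is [0] or [k i]; the eigenvalues of the
    adjacency matrix are integer combinations of such entries. *)
Lemma int_spectrum (I : finType) (c k : I -> int) (N : I -> 'M[algC]_#|T|) :
    (forall i j, comm_mx (N i) (N j)) ->
    (forall i, N i *m N i = (k i)%:~R *: N i) ->
    adjacency_matrix e = \sum_i (c i)%:~R *: N i ->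
  integral_graph e.
Proof.
move=> Ncomm Nsqr defA a.
have [|P /unitarymx_unit Pu /allP trigN] :=
    @cotrigonalization algC _ [seq N i | i <- index_enum I].
  by move=> _ _ /mapP[i _ ->] /mapP[j _ ->].
have {}trigN i : is_trig_mx (conjmx P (N i)).
  by apply: trigN; rewrite map_f ?mem_index_enum.
have Nint i j : conjmx P (N i) j j \is a Num.int.
  have := trigmx_mul_diag j (trigN i) (trigN i).
  rewrite -conjumxM // Nsqr !conjumx // -scalemxAr -scalemxAl mxE -conjumx //.
  set x := conjmx _ _ _ _ => /eqP; rewrite eq_sym -subr_eq0 -mulrBl mulf_eq0.
  case/orP=> [|/eqP->]; rewrite ?rpred0 // subr_eq0 => /eqP->.
  exact: intr_int.
have defPA : conjmx P (adjacency_matrix e) = \sum_i (c i)%:~R *: conjmx P (N i).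
  rewrite defA conjumx // mulmx_sumr mulmx_suml; apply: eq_bigr => i _.
  by rewrite -scalemxAr -scalemxAl conjumx.
have trigA : is_trig_mx (conjmx P (adjacency_matrix e)).
  apply/is_trig_mxP => i j ltij; rewrite defPA summxE big1 // => l _.
  by rewrite mxE (is_trig_mxP (trigN l)) ?mulr0.
rewrite (perm_mem (spectrum_trig Pu trigA)) => /mapP[j _ ->].
rewrite defPA summxE rpred_sum // => i _.
by rewrite mxE rpredM ?intr_int.
Qed.

End Spectrum.

(** * Local rings and their products *)

Section FiniteRings.

Variable F : finComNzRingType.

Lemma mulrn_card (x : F) : x *+ #|F| = 0.
Proof. by rewrite -FinRing.zmodXgE -cardsT expg_cardG ?inE. Qed.

(** As the additive order of [1] divides the odd number [#|F|], [1] is the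
    double of a multiple of itself. *)
Lemma odd_card_half : odd #|F| -> exists h : F, h + h = 1.
Proof.
move=> oddF; have := mulrn_card 1; rewrite -(odd_double_half #|F|) oddF.
rewrite mulrnDr mulr1n -addnn mulrnDr => /eqP; rewrite addr_eq0 => /eqP defu.
by exists (- 1 *+ #|F|./2); rewrite !mulNrn -opprD -defu.
Qed.

Lemma even_card_torsion : ~~ odd #|F| -> exists2 t : F, t != 0 & t + t = 0.
Proof.
rewrite -dvdn2 -cardsT => /(@Cauchy _ 2 [set: F]%G)[] // t _ ot.
exists t; last by rewrite -mulr2n -FinRing.zmodXgE -ot expg_order.
by apply: contraTneq isT => t0; have := order1 F; rewrite -[1%g]t0 ot.
Qed.

(** A boolean form of [idealr_closed], needed to choose a maximal set with this
    property. *)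
Definition is_ideal (I : {set F}) :=
  [&& 0 \in I, 1 \notin I &
      [forall a, forall u in I, forall v in I, a * u + v \in I]].

Lemma is_idealP (I : {set F}) : reflect (idealr_closed I) (is_ideal I).
Proof.
apply: (iffP and3P) => -[I0 I1 IM]; split=> //.
  move=> a u v uI vI.
  by have /forallP/(_ a)/forall_inP/(_ u uI)/forall_inP-> := IM.
apply/forallP=> a; apply/forall_inP=> u uI; apply/forall_inP=> v vI.
exact: IM.
Qed.

Lemma ideal_sub_maximal (I : {set F}) :
  idealr_closed I -> exists2 M : {set F}, maximal_ideal M & I \subset M.
Proof.
move=> /is_idealP/maxset_exists[M /maxsetP[/is_idealP idM maxM] subIM].
by exists M => //; split=> // J /is_idealP idJ /maxM->.
Qed.

(** A non-invertible [x] generates a proper ideal, which lies in a maximal one,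
    that is, in [M]. *)
Lemma local_unit (M : {set F}) x :
  local_with M -> x \notin M -> exists y, x * y = 1.
Proof.
move=> [_ uniqM] xM; apply/exists_eqP; apply: contraR xM => noinv.
have idx : idealr_closed [set x * y | y : F].
  split; first by apply/imsetP; exists 0; rewrite ?mulr0.
    apply: contra noinv => /imsetP[y _ defy].
    by apply/existsP; exists y; rewrite -defy.
  move=> a _ _ /imsetP[y _ ->] /imsetP[z _ ->].
  by apply/imsetP; exists (a * y + z) => //; rewrite mulrDr mulrCA.
have [N /uniqM-> /subsetP subxM] := ideal_sub_maximal idx.
by apply: subxM; apply/imsetP; exists 1; rewrite ?mulr1.
Qed.

Section Avoidance.

Variable M : {set F}.
Hypothesis idM : idealr_closed M.

Lemma ideal0 : 0 \in M. Proof. by case: idM. Qed.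
Lemma ideal1 : 1 \notin M. Proof. by case: idM. Qed.
Lemma idealB x y : x \in M -> y \in M -> x - y \in M.
Proof. by move=> xM yM; have [_ _ IM] := idM; rewrite addrC -mulN1r IM. Qed.
Lemma idealMl a x : x \in M -> a * x \in M.
Proof. by move=> xM; have [M0 _ IM] := idM; rewrite -[_ * _]addr0 IM. Qed.
Lemma idealDr x y : y \in M -> (x + y \in M) = (x \in M).
Proof.
move=> yM; apply/idP/idP => [xyM | xM]; first by rewrite -(addrK y x) idealB.
by rewrite -[y]opprK idealB // -[- y]sub0r idealB // ideal0.
Qed.

Definition avoid (t : F) : nat :=
  #|[pred z | (z \notin M) && (z + t \notin M)]|.

Lemma card_shift (t : F) : #|[set z | z + t \in M]| = #|M|.
Proof.
by rewrite -(card_preimset _ (addIr t)); apply: eq_card => z; rewrite !inE.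
Qed.

(** The complement of the avoiding set is the union of two cosets of [M], of
    size [#|M|] each; they are disjoint or equal. *)
Lemma avoidE t :
  (avoid t + #|M :|: [set z | (z + t)%R \in M]| = #|F|)%N.
Proof.
rewrite addnC -[RHS](cardsC (M :|: [set z | z + t \in M])%SET); congr addn.
by apply: eq_card => z; rewrite !inE negb_or.
Qed.

Lemma avoid_notin t : t \notin M -> (avoid t + #|M|.*2 = #|F|)%N.
Proof.
move=> tM; rewrite -(avoidE t) cardsU card_shift addnn.
suff -> : M :&: [set z | z + t \in M] = set0 by rewrite cards0 subn0.
apply/setP=> z; rewrite !inE; apply/negP=> /andP[zM].
by rewrite addrC idealDr // (negPf tM).
Qed.

Lemma avoid_in t : t \in M -> (avoid t + #|M| = #|F|)%N.
Proof.
move=> tM; rewrite -(avoidE t); congr (_ + #|pred_of_set _|)%N.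
by apply/setP=> z; rewrite !inE idealDr // orbb.
Qed.

Lemma card_ideal_gt0 : (0 < #|M|)%N.
Proof. by apply/card_gt0P; exists 0; apply: ideal0. Qed.

Lemma avoid_notin_const t : t \notin M -> avoid t = avoid 1.
Proof.
by move=> tM; apply/(@addIn #|M|.*2); rewrite !avoid_notin // ideal1.
Qed.

Lemma avoid_in_gt t : t \in M -> (avoid 1%R < avoid t)%N.
Proof.
move=> tM; rewrite -(ltn_add2r #|M|.*2) avoid_notin ?ideal1 //.
by rewrite -addnn addnA avoid_in // -addn1 leq_add2l card_ideal_gt0.
Qed.

(** Only an odd [#|F|] needs an argument: [avoid 1 + 2 * #|M| = #|F|], so
    [avoid 1] is odd too. *)
Lemma avoid1_gt0 :
  (~~ odd #|F| -> (#|M| < #|F|./2)%N) -> (0 < avoid 1%R)%N.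
Proof.
have cardF := avoid_notin ideal1.
case: posnP => // av0; rewrite av0 in cardF.
by rewrite -cardF odd_double doubleK ltnn => /(_ isT).
Qed.

Lemma odd_card_two_notin : odd #|F| -> 1 + 1 \notin M.
Proof.
case/odd_card_half=> h defh; apply: contra ideal1 => M2.
by rewrite -defh -[h]mulr1 -mulrDr idealMl.
Qed.

End Avoidance.

End FiniteRings.

Section Decomposition.

Variables (R : finComUnitRingType) (D : local_decomposition R).

Lemma component_inj x y :
  (forall i : 'I_(nb_factors D), component i x = component i y) -> x = y.
Proof.
move=> eqxy; apply: (bij_inj (component_bij D)) => /=.
by apply/ffunP=> i; rewrite !ffunE eqxy.
Qed.

Lemma component_surj (f : forall i, factor D i) :
  exists x, forall i : 'I_(nb_factors D), component i x = f i.
Proof.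
have [g _ gK] := component_bij D.
exists (g [ffun i => f i]) => i; have /ffunP/(_ i) := gK [ffun i => f i].
by rewrite !ffunE.
Qed.

Lemma factor_ideal i : idealr_closed (factor_max D i).
Proof. by have [[]] := factor_local i. Qed.

Lemma unit_components (x : R) :
  (x \is a GRing.unit) =
  [forall i : 'I_(nb_factors D), component i x \notin factor_max D i].
Proof.
apply/idP/forallP => [xu i | xM].
  apply: contra (ideal1 (factor_ideal i)) => xM.
  rewrite -(rmorph1 (component i)) -(mulVr xu) rmorphM.
  by rewrite idealMl //; apply: factor_ideal.
have inv i := local_unit (factor_local i) (xM i).
have [f deff] := fin_all_exists inv; have [y defy] := component_surj f.
apply/unitrPr; exists y; apply: component_inj => i.
by rewrite rmorphM rmorph1 defy deff.
Qed.

(** An element of [R] is a unit when each of its components avoids the maximal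
    ideal of the factor, and the components can be chosen independently. *)
Lemma card_common_avoid (t : R) :
  #|[pred z | (z \is a GRing.unit) && (z + t \is a GRing.unit)]| =
  (\prod_(i < nb_factors D) avoid (factor_max D i) (component i t))%N.
Proof.
pose F (i : 'I_(nb_factors D)) := [pred z | (z \notin factor_max D i) &&
                      (z + component i t \notin factor_max D i)].
transitivity #|(family F : simpl_pred {dffun forall i, factor D i})|; last first.
  by rewrite card_family foldrE big_image.
have phi_bij := component_bij D; rewrite -(card_image (bij_inj phi_bij)).
apply: eq_card => f; have [g gK Kg] := phi_bij.
rewrite -[f in LHS]Kg (mem_image (bij_inj phi_bij)) -[f in RHS]Kg.
rewrite !inE !unit_components.
apply/andP/familyP => [[/forallP zM /forallP ztM] i | zF].
  by rewrite !inE ffunE zM -rmorphD ztM.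
split; apply/forallP=> i; have := zF i; rewrite !inE ffunE => /andP[] //.
by rewrite rmorphD.
Qed.

End Decomposition.

(** * Matrices of the two graphs *)

Section TranslationInvariant.

Variable V : finZmodType.
Implicit Types f g : V -> algC.

(** The matrix of the convolution by [g] on the functions on [V]. *)
Definition translation_mx g : 'M[algC]_#|V| :=
  \matrix_(i, j) g (enum_val j - enum_val i).

Lemma translation_mxM f g :
  translation_mx f *m translation_mx g =
  translation_mx (fun x => \sum_y f y * g (x - y)).
Proof.
apply/matrixP=> i k; rewrite !mxE.
transitivity (\sum_y f (y - enum_val i) * g (enum_val k - y)).
  by rewrite [RHS]big_enum_val; apply: eq_bigr => j _; rewrite !mxE.
rewrite (reindex_inj (addrI (enum_val i))); apply: eq_bigr => y _.
by rewrite addrAC subrr add0r opprD addrA.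
Qed.

Lemma translation_mx_comm f g : comm_mx (translation_mx f) (translation_mx g).
Proof.
rewrite /comm_mx !translation_mxM; apply/matrixP=> i j; rewrite !mxE.
set x := _ - _; rewrite (reindex_inj (subrI x)); apply: eq_bigr => y _.
by rewrite mulrC opprB addrC subrK.
Qed.

(** Convolution multiplies total sums. *)
Lemma translation_mxX f k : exists2 g,
  translation_mx f ^+ k = translation_mx g & \sum_x g x = (\sum_x f x) ^+ k.
Proof.
elim: k => [|k [g defg sumg]].
  exists (fun x => (x == 0)%:R).
    apply/matrixP=> i j; rewrite expr0 !mxE subr_eq0 eq_sym.
    by rewrite (inj_eq enum_val_inj).
  by rewrite expr0 (bigD1 0) //= eqxx big1 ?addr0 // => x /negPf->.
exists (fun x => \sum_y f y * g (x - y)).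
  by rewrite exprS defg -translation_mxM.
rewrite exchange_big exprS -sumg mulr_suml; apply: eq_bigr => y _.
by rewrite -mulr_sumr; congr (_ * _); rewrite (reindex_inj (addIr y)) /=;
   apply: eq_bigr => x _; rewrite addrK.
Qed.

(** Up to a scalar, the indicator of a subgroup is an idempotent for the
    convolution. *)
Lemma translation_mx_subgroup_sqr (I : {set V}) :
    {in I, forall y x, (x - y \in I) = (x \in I)} ->
  let N := translation_mx (fun x => (x \in I)%:R) in N *m N = #|I|%:R *: N.
Proof.
move=> subI N; rewrite translation_mxM; apply/matrixP=> i j; rewrite !mxE.
set x := _ - _; rewrite -sum1_card natr_sum mulr_suml [RHS]big_mkcond.
apply: eq_bigr => y _; case: ifP => [yI | _]; last by rewrite mul0r.
by rewrite subI.
Qed.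

End TranslationInvariant.

Section UnitaryCayley.

Variable R : finComUnitRingType.
Local Notation A := (adjacency_matrix (@unitary_cayley R)).
Local Notation A' := (adjacency_matrix (@unitary_cayley_sum R)).
Local Notation U := [pred x : R | x \is a GRing.unit].

Lemma adjacency_cayley :
  A = translation_mx (fun x : R => (x \is a GRing.unit)%:R).
Proof. by apply/matrixP=> i j; rewrite !mxE. Qed.

(** For [J] a set of factors, [I J] is the intersection of the corresponding
    maximal ideals of [R]; the indicator of the units is expanded by
    inclusion-exclusion over [J]. *)
Lemma integral_cayley (D : local_decomposition R) :
  integral_graph (@unitary_cayley R).
Proof.
pose I (J : {set 'I_(nb_factors D)}) :=
  [set x : R | [forall i in J, component i x \in factor_max D i]].
apply: (@int_spectrum R _ {set 'I_(nb_factors D)}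
          (fun J => (- 1) ^+ #|J|) (fun J => #|I J|%:Z)
          (fun J => translation_mx (fun x => (x \in I J)%:R))) => [J K|J|].
- exact: translation_mx_comm.
- apply: translation_mx_subgroup_sqr => y yI x; rewrite !inE.
  apply: eq_forallb_in => i iJ; rewrite rmorphB.
  have yM : component i y \in factor_max D i.
    by move: yI; rewrite inE => /forall_inP/(_ i iJ).
  have idM := factor_ideal i.
  rewrite -[in RHS](subrK (component i y) (component i x)).
  by rewrite [RHS](idealDr idM).
rewrite adjacency_cayley; apply/matrixP=> i j; rewrite summxE !mxE.
set x := _ - _; under eq_bigr do rewrite !mxE -/x.
rewrite (unit_components D).
transitivity (\prod_(l < nb_factors D)
    (- (component l x \in factor_max D l)%:R + 1 : algC)).
  case: forallP => [xM | xM].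
    by rewrite big1 // => l _; rewrite (negPf (xM l)) oppr0 add0r.
  have /existsP[l xMl] : [exists l, component l x \in factor_max D l].
    by apply: contra_notT xM => /existsPn.
  by rewrite (bigD1 l) //= xMl addNr mul0r.
rewrite bigA_distr; apply: eq_bigr => J _.
rewrite -big_mkcond prodrN rmorphXn rmorphN1; congr (_ * _).
rewrite inE; case: (boolP [forall _ in _, _]) => [/forall_inP xJ | xJ].
  by rewrite big1 // => l /xJ->.
move: xJ; rewrite negb_forall_in => /exists_inP[l lJ /negPf xl].
by rewrite (bigD1 l) //= xl mul0r.
Qed.

(** Negating the middle vertex of a walk of length two turns sums into
    differences. *)
Lemma adjacency_cayley_sum_sqr : A' *m A' = A *m A.
Proof.
apply/matrixP=> i k; rewrite !mxE.
transitivity (\sum_(y : R) ((enum_val i + y \is a GRing.unit)%:R *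
                    (y + enum_val k \is a GRing.unit)%:R : algC)).
  by rewrite [RHS]big_enum_val; apply: eq_bigr => j _; rewrite !mxE.
rewrite (reindex_inj oppr_inj) /= [LHS]big_enum_val.
apply: eq_bigr => j _; rewrite !mxE /unitary_cayley.
by rewrite -unitrN opprB [- enum_val j + _]addrC.
Qed.

Lemma spectrum_cayley_sqr :
  perm_eq [seq a ^+ 2 | a <- spectrum (@unitary_cayley_sum R)]
          [seq a ^+ 2 | a <- spectrum (@unitary_cayley R)].
Proof.
apply: perm_eq_power_sums => k; rewrite !big_map.
under eq_bigr do rewrite -exprM.
under [RHS]eq_bigr do rewrite -exprM.
by rewrite !sum_spectrum_exp !exprM !expr2 -!mulmxE adjacency_cayley_sum_sqr.
Qed.

Lemma regular_cayley_sum : regular (@unitary_cayley_sum R) #|U|.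
Proof.
by move=> x; rewrite -!sum1_card [RHS](reindex_inj (addrI x)).
Qed.

(** Write [A' ^+ k] as [A'] times an even power of [A], the convolution by some
    [g].  The trace is the sum of [u (x + y) * g (x - y)], with [u] the
    indicator of the units, and the change of variables given by [x + y] and
    [x - y] splits it into the product of the sums of [u] and [g]. *)
Lemma mxtrace_cayley_sum_odd (h : R) k : h + h = 1 -> odd k ->
  \tr (A' ^+ k) = #|U|%:R ^+ k.
Proof.
move=> hh oddk.
have hD z : h * (z + z) = z by rewrite mulrDr -mulrDl hh mul1r.
rewrite -(odd_double_half k) oddk add1n exprS -mul2n exprM.
rewrite expr2 -mulmxE adjacency_cayley_sum_sqr mulmxE -expr2 -exprM.
rewrite adjacency_cayley.
set u := fun x : R => _.
have [g -> sumg] := translation_mxX u (2 * k./2).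
have -> : #|U|%:R = \sum_x u x.
  rewrite -sum1_card natr_sum big_mkcond; apply: eq_bigr => x _.
  by rewrite /u inE; case: ifP.
rewrite [RHS]exprS -sumg.
transitivity (\sum_x \sum_y u (x + y) * g (x - y)).
  rewrite [RHS]big_enum_val; apply: eq_bigr => i _; rewrite mxE.
  by rewrite [RHS]big_enum_val; apply: eq_bigr => j _; rewrite !mxE.
rewrite pair_big mulr_suml.
under [RHS]eq_bigr do rewrite mulr_sumr.
rewrite pair_big /=.
rewrite [RHS](reindex (fun p : R * R => (p.1 + p.2, p.1 - p.2))) //=.
exists (fun p : R * R => (h * (p.1 + p.2), h * (p.1 - p.2))) => -[x y] _ /=.
  rewrite opprB addrACA subrr addr0 [x + y]addrC addrACA subrr addr0.
  by rewrite !hD.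
rewrite -mulrDr -mulrBr opprB addrACA subrr addr0.
by rewrite [x + y]addrC addrACA subrr addr0 !hD.
Qed.

End UnitaryCayley.

(** * Comparison of the two graphs *)

Section Consequences.

Variable R : finComUnitRingType.
Local Notation G := (@unitary_cayley R).
Local Notation G' := (@unitary_cayley_sum R).
Local Notation U := [pred x : R | x \is a GRing.unit].

(** The absolute value of [a] is a function of [a ^+ 2]. *)
Lemma equienergetic_cayley : equienergetic G G'.
Proof.
split=> //; rewrite /energy.
have normE (s : seq algC) :
    \sum_(a <- s) `|a| = \sum_(b <- [seq a ^+ 2 | a <- s]) sqrtC `|b|.
  by rewrite big_map; apply: eq_bigr => a _; rewrite normrX sqrCK.
by rewrite !normE (perm_big _ (spectrum_cayley_sqr R)).
Qed.

Lemma integral_cayley_sum (D : local_decomposition R) : integral_graph G'.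
Proof.
move=> a aS; have : a ^+ 2 \in [seq b ^+ 2 | b <- spectrum G].
  rewrite -(perm_mem (spectrum_cayley_sqr R)).
  exact: (map_f (fun b => b ^+ 2)) aS.
case/mapP=> b /(integral_cayley D) bint /eqP.
by rewrite eqf_sqr => /orP[] /eqP->; rewrite ?rpredN.
Qed.

(** Adding [- d] to the spectrum kills all odd power sums, so the result has the
    same power sums as its opposite. *)
Lemma cayley_sum_almost_symmetric : odd #|R| -> strongly_almost_symmetric G'.
Proof.
move=> oddR; have [h hh] := odd_card_half oddR.
set d : algC := #|U|%:R; pose S := spectrum G'.
have d_gt0 : 0 < d.
  by rewrite ltr0n; apply/card_gt0P; exists 1; rewrite inE unitr1.
have permS : perm_eq (- d :: S) (d :: [seq - a | a <- S]).
  apply: perm_eq_power_sums => k; rewrite !big_cons big_map.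
  have [oddk | evenk] := boolP (odd k); last first.
    have exprNe x : (- x) ^+ k = x ^+ k :> algC.
      by rewrite exprNn -signr_odd (negPf evenk) mul1r.
    by rewrite exprNe; under [in RHS]eq_bigr do rewrite exprNe.
  have exprNo x : (- x) ^+ k = - x ^+ k :> algC.
    by rewrite exprNn -signr_odd oddk mulN1r.
  under [in RHS]eq_bigr do rewrite exprNo.
  rewrite exprNo sumrN sum_spectrum_exp (mxtrace_cayley_sum_odd hh oddk).
  by rewrite subrr addNr.
have mult v : ((- d == v) + eig_mult G' v = (d == v) + eig_mult G' (- v))%N.
  have /seq.permP/(_ (pred1 v)) := permS; rewrite /= count_map => ->.
  congr addn.
  by apply: eq_count => a /=; rewrite eqr_oppLR.
exists #|U|; first exact: regular_cayley_sum.
split=> [a nad naNd|].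
  by have := mult a; rewrite ![_ == a]eq_sym (negPf nad) (negPf naNd).
have Nd : (- d == d) = false by rewrite eqNr (negPf (lt0r_neq0 d_gt0)).
have := mult d; rewrite eqxx Nd add0n -/d => ->.
by rewrite PoszD addrK.
Qed.

Lemma even_cayley_sum_loopless : ~~ odd #|R| -> loopless G'.
Proof.
case/even_card_torsion=> t t0 tt x; rewrite /unitary_cayley_sum.
apply: contra t0 => xu; rewrite -(mulrI_eq0 _ (mulrI xu)).
by rewrite mulrDl -mulrDr tt mulr0.
Qed.

Lemma odd_cayley_sum_loop : odd #|R| -> has_loop G'.
Proof.
case/odd_card_half=> h hh; exists 1; apply/unitrPr; exists h.
by rewrite mulrDl mul1r.
Qed.

(** The number of common neighbours in G_R of two vertices that differ by [t]. *)
Definition codegree (t : R) : nat :=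
  #|[pred z : R | (z \is a GRing.unit) && (z + t \is a GRing.unit)]|.

Hypothesis oddR : odd_type R.

Lemma codegree_gt0 t : (0 < codegree t)%N.
Proof.
have [D [Dev _]] := oddR; rewrite /codegree (card_common_avoid D).
rewrite prodn_gt0 // => i; have idM := factor_ideal i.
have av1 := avoid1_gt0 idM (Dev i).
have [tM | /avoid_notin_const-> //] := boolP (component i t \in factor_max D i).
exact: leq_ltn_trans (avoid_in_gt idM tM).
Qed.

Lemma codegree_min t : (codegree 1%R <= codegree t)%N.
Proof.
have [D _] := oddR; rewrite /codegree !(card_common_avoid D).
apply: leq_prod => i _; rewrite rmorph1; have idM := factor_ideal i.
have [tM | /avoid_notin_const-> //] := boolP (component i t \in factor_max D i).
exact: ltnW (avoid_in_gt idM tM).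
Qed.

Lemma codegree_unit t : t \is a GRing.unit -> codegree t = codegree 1.
Proof.
have [D _] := oddR; rewrite /codegree !(card_common_avoid D) (unit_components D).
move=> /forallP tM; apply: eq_bigr => i _; rewrite rmorph1.
by rewrite (avoid_notin_const (factor_ideal i) (tM i)).
Qed.

(** Take [x = 1] and for [y] the idempotent of a factor of odd cardinality:
    [x + y] has components [2] there and [1] elsewhere, all units, while [x - y]
    vanishes in that factor. *)
Lemma codegree_gap : exists x y : R,
  x + y \is a GRing.unit /\ (codegree 1%R < codegree (x - y)%R)%N.
Proof.
have [D [Dev [i0 oddi0]]] := oddR.
have [y defy] := component_surj (fun i : 'I_(nb_factors D) => (i == i0)%:R).
exists 1, y; split.
  rewrite (unit_components D); apply/forallP=> i; rewrite rmorphD rmorph1 defy.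
  have idM := factor_ideal i; case: eqP => [-> | _]; last by rewrite addr0 ideal1.
  exact: odd_card_two_notin (factor_ideal i0) oddi0.
rewrite /codegree !(card_common_avoid D) !(bigD1 i0 (P := xpredT)) //=.
have av1 i := avoid1_gt0 (factor_ideal i) (Dev i).
have yM : component i0 (1 - y) \in factor_max D i0.
  by rewrite rmorphB rmorph1 defy eqxx subrr (ideal0 (factor_ideal i0)).
rewrite rmorph1; pose av i x := avoid (factor_max D i) (component i x).
apply: leq_trans (_ : _ < av i0 (1 - y)%R * \prod_(i | i != i0) av i 1%R)%N _.
  rewrite ltn_pmul2r ?(avoid_in_gt (factor_ideal i0) yM) //.
  by rewrite prodn_cond_gt0 // => i _; rewrite rmorph1.
rewrite leq_mul2l; apply/orP; right; apply: leq_prod => i ni0.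
by rewrite rmorphB defy (negPf ni0) subr0.
Qed.

(** Applied to [- x] and [- y], this gives common neighbours in G_R^+ too. *)
Lemma common_neighbor x y : exists2 z, G x z & G y z.
Proof.
have /card_gt0P[w] := codegree_gt0 (x - y); rewrite inE => /andP[wu wxu].
by exists (x + w); rewrite /unitary_cayley addrAC ?subrr ?add0r // addrC.
Qed.

Lemma connected_cayley : connected_graph G.
Proof.
move=> x y; have [z xz yz] := common_neighbor x y.
by apply: connect_trans (connect1 xz) (connect1 _); rewrite unitary_cayley_sym.
Qed.

Lemma connected_cayley_sum : connected_graph G'.
Proof.
move=> x y; have [z xz yz] := common_neighbor (- x) (- y).
apply: (connect_trans (connect1 (y := z) _) (connect1 _)).
  by rewrite /unitary_cayley_sum addrC -[x]opprK.
by rewrite /unitary_cayley_sum -[y]opprK.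
Qed.

Lemma triangle_not_bipartite (T : finType) (e : rel T) x y z :
  e x y -> e y z -> e x z -> ~ bipartite e.
Proof.
move=> xy yz xz [c cP]; move: (cP _ _ xy) (cP _ _ yz) (cP _ _ xz).
by do 3!case: (c _).
Qed.

Lemma cayley_not_bipartite : ~ bipartite G.
Proof.
have [z z0 z1] := common_neighbor 0 1.
apply: (triangle_not_bipartite _ z1 z0).
by rewrite /unitary_cayley subr0 unitr1.
Qed.

Lemma cayley_sum_not_bipartite : ~ bipartite G'.
Proof.
have [z z0 z1] := common_neighbor 0 (- 1).
apply: (@triangle_not_bipartite _ _ 0 1 z); rewrite /unitary_cayley_sum.
- by rewrite add0r unitr1.
- by rewrite addrC -[1]opprK.
by rewrite add0r -[z]subr0.
Qed.

(** Compare the numbers of closed walks of length three, as sums over edges of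
    numbers of common neighbours. *)
Lemma not_isospectral_cayley : ~ isospectral G G'.
Proof.
move=> isoG.
have : \sum_(a <- spectrum G) a ^+ 3 = \sum_(a <- spectrum G') a ^+ 3.
  exact: perm_big.
rewrite !sum_spectrum_exp !mxtrace_adjacency_cube => /eqP; rewrite eqr_nat.
apply/negP; rewrite neq_ltn; apply/orP; left.
have cardG x y :
    #|[pred z | G y z & G z x]| = codegree (y - x).
  rewrite /codegree -!sum1_card (reindex_inj (addrI y)); apply: eq_bigl => w.
  rewrite !inE /unitary_cayley [y + w]addrC addrK; congr (_ && _).
  by rewrite -unitrN opprB addrA.
have cardG' x y :
    #|[pred z | G' y z & G' z x]| = codegree (x - y).
  rewrite /codegree -!sum1_card (reindex_inj (addrI (- y))); apply: eq_bigl => w.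
  rewrite !inE /unitary_cayley_sum addrA subrr add0r; congr (_ && _).
  by rewrite addrAC addrC [- y + x]addrC.
have -> : (\sum_x \sum_(y | G x y) #|[pred z | G y z & G z x]|
         = \sum_x \sum_(y | G' x y) codegree 1%R)%N.
  apply: eq_bigr => x _; transitivity (\sum_(y | G x y) codegree 1%R)%N.
    by apply: eq_bigr => y xy; rewrite cardG codegree_unit.
  (* The neighbours of [x] in G_R are the translates by [x + x] of its
     neighbours in G_R^+. *)
  rewrite (reindex_inj (addrI (x + x))); apply: eq_bigl => y.
  by rewrite /unitary_cayley -[x + x + y]addrA [x + (x + y)]addrC addrK.
under [X in (_ < X)%N]eq_bigr do under eq_bigr do rewrite cardG'.
rewrite !pair_big_dep /=.
have /leqif_sum/ltn_leqif-> : forall p : R * R, G' p.1 p.2 ->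
    (codegree 1%R <= codegree (p.1 - p.2)%R ?= iff
       (codegree 1%R == codegree (p.1 - p.2)%R))%N.
  by move=> p _; split=> //; apply: codegree_min.
have [x [y [xy gap]]] := codegree_gap.
by apply/forall_inPn; exists (x, y) => //=; rewrite ltn_eqF.
Qed.

End Consequences.

Theorem theorem3p7 (R : finComUnitRingType) (hR : odd_type R) :
  let G := @unitary_cayley R in
  let Gp := @unitary_cayley_sum R in
  [/\ integral_graph G /\ integral_graph Gp,
      equienergetic G Gp,
      ~ isospectral G Gp,
      connected_graph G /\ connected_graph Gp &
      ~ bipartite G /\ ~ bipartite Gp] /\
  (~~ odd #|R| -> loopless Gp) /\
  (odd #|R| -> strongly_almost_symmetric Gp /\ has_loop Gp).
Proof.
have [D _] := hR; move=> G Gp; split; first split.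
- by split; [apply: integral_cayley D | apply: integral_cayley_sum D].
- exact: equienergetic_cayley.
- exact: not_isospectral_cayley.
- by split; [apply: connected_cayley | apply: connected_cayley_sum].
- by split; [apply: cayley_not_bipartite | apply: cayley_sum_not_bipartite].
split; first exact: even_cayley_sum_loopless.
by split; [apply: cayley_sum_almost_symmetric | apply: odd_cayley_sum_loop].
Qed.
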